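(* Let $f,g:\{-1,1\}^n\to\{-1,1\}$ be two balanced low-correlation self-predicting functions that depend on all $n$ variables, and assume that $f$ is strongly spectral threshold. Then \[\Pr(f(X^n)\neq g(X^n))\le\frac{d_{\mathrm{Chow}}^2(f,g)}{2\,\mathrm{Gap}[f]},\] where $X^n$ is uniform on $\{-1,1\}^n$ (the right-hand side is interpreted as $+\infty$ if $\mathrm{Gap}[f]=0$).
   Context: $\hat f_S=\mathbb{E}[f(X^n)\prod_{i\in S}X_i]$, $\hat f_i=\hat f_{\{i\}}$. Balanced means $\Pr(f(X^n)=1)=1/2$. Chow distance: $d_{\mathrm{Chow}}(f,g)=\left(\sum_{i=1}^n(\hat f_i-\hat g_i)^2\right)^{1/2}$. $\mathrm{Gap}[f]$ is the minimal positive value of $\sum_{i=1}^n\hat f_ix_i$ over $x^n\in\{-1,1\}^n$ ($\mathrm{Gap}[f]=0$ if all $\hat f_i=0$). With $W^k[f]=\sum_{|S|=k}\hat f_S^2$, $\mathrm{Lev}(f)=\min\{k\ge0:W^k[f]>0\}$ and $f_{\mathrm{Lev}}=\sum_{|S|=\mathrm{Lev}(f)}\hat f_S\prod_{i\in S}x_i$; $f$ is strongly spectral threshold if $f_{\mathrm{Lev}}(x^n)\ne0$ and $f_{\mathrm{Lev}}(x^n)f(x^n)>0$ for all $x^n$. For $\rho\in[0,1]$, $T_\rho f=\sum_S\rho^{|S|}\hat f_S\prod_{i\in S}x_i$; $\operatorname{sgn}(0)=0$; $f$ is $\rho$-SP if $f(y^n)=\operatorname{sgn}T_\rho f(y^n)$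 whenever $T_\rho f(y^n)\ne0$; $f$ is low-correlation self-predicting if there is $\rho^*>0$ with $f$ $\rho$-SP for all $\rho\in[0,\rho^* )$. *)

(* Defs.v *)
From HB Require Import structures.
From mathcomp Require Import all_boot all_order all_algebra.
From mathcomp Require Import reals constructive_ereal.
Set Implicit Arguments.
Unset Strict Implicit.
Unset Printing Implicit Defensive.
Import Order.TTheory GRing.Theory Num.Theory.
Local Open Scope ring_scope.

(* The two-point set {-1, 1} is encoded by bool, with false standing for 1 and
   true for -1; [pm1] is the embedding into the reals. *)
Definition pm1 (R : realType) (b : bool) : R := (-1) ^+ b.

Definition cube (n : nat) := {ffun 'I_n -> bool}.

Definition boolfun (n : nat) := cube n -> bool.

Section BooleanAnalysis.
Variables (R : realType) (n : nat).
Implicit Types (f g : boolfun n) (x y : cube n) (S : {set 'I_n}).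

Definition Ex (h : cube n -> R) : R := (\sum_x h x) / (2 ^ n)%:R.

Definition Pr (A : pred (cube n)) : R := #|A|%:R / (2 ^ n)%:R.

Definition pmval f x : R := pm1 R (f x).

Definition chi S x : R := \prod_(i in S) pm1 R (x i).

Definition fourier f S : R := Ex (fun x => pmval f x * chi S x).

Definition fourier1 f (i : 'I_n) : R := fourier f [set i].

Definition balanced f : Prop := Pr [pred x | pmval f x == 1] = 1 / 2.

Definition flip (i : 'I_n) x : cube n := [ffun j => (j == i) (+) x j].

Definition depends_on_all f : Prop :=
  forall i : 'I_n, exists x, pmval f (flip i x) <> pmval f x.

Definition dChow f g : R :=
  Num.sqrt (\sum_(i < n) (fourier1 f i - fourier1 g i) ^+ 2).

Definition linear_form f x : R := \sum_(i < n) fourier1 f i * pm1 R (x i).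

(* [linear_form f] takes a positive value unless all degree-1 coefficients
   vanish, so the default value 0 is used exactly in that case. *)
Definition Gap f : R :=
  if [pick x | (0 < linear_form f x) &&
        [forall y, (0 < linear_form f y) ==>
                     (linear_form f x <= linear_form f y)]] is Some x
  then linear_form f x else 0.

Definition weight f (k : nat) : R :=
  \sum_(S : {set 'I_n} | #|S| == k) fourier f S ^+ 2.

(* By Parseval some weight of level at most n is positive, hence [find] does
   return the least such level. *)
Definition Lev f : nat := find (fun k => 0 < weight f k) (iota 0 n.+1).

Definition fLev f x : R :=
  \sum_(S : {set 'I_n} | #|S| == Lev f) fourier f S * chi S x.

Definition strongly_spectral_threshold f : Prop :=
  forall x, fLev f x <> 0 /\ 0 < fLev f x * pmval f x.

Definition noise (rho : R) f x : R :=
  \sum_(S : {set 'I_n}) rho ^+ #|S| * fourier f S * chi S x.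

Definition self_predicting (rho : R) f : Prop :=
  forall y, noise rho f y <> 0 -> pmval f y = Num.sg (noise rho f y).

(* The bound [rho_star <= 1] only keeps rho in the domain [0, 1] of the noise
   operator; rho_star can always be decreased. *)
Definition low_correlation_self_predicting f : Prop :=
  exists rho_star : R, 0 < rho_star <= 1 /\
    forall rho : R, 0 <= rho < rho_star -> self_predicting rho f.

End BooleanAnalysis.

Arguments Ex {R n} h.
Arguments Pr R {n} A.
Arguments pmval R {n} f x.
Arguments chi R {n} S x.
Arguments fourier R {n} f S.
Arguments fourier1 R {n} f i.
Arguments balanced R {n} f.
Arguments depends_on_all R {n} f.
Arguments dChow R {n} f g.
Arguments linear_form R {n} f x.
Arguments Gap R {n} f.
Arguments weight R {n} f k.
Arguments Lev R {n} f.
Arguments fLev R {n} f x.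
Arguments strongly_spectral_threshold R {n} f.
Arguments low_correlation_self_predicting R {n} f.

(* Main.v *)
Require Import Defs.
From mathcomp Require Import all_boot all_order all_algebra.
From mathcomp Require Import reals constructive_ereal.
From mathcomp Require Import ring lra.
Import Order.TTheory GRing.Theory Num.Theory.
Local Open Scope ring_scope.

(** Write [l_f], [l_g] for the degree-1 parts of [f], [g].  By Plancherel,
    d_Chow(f,g)^2 = E[(f - g) l_f] + E[(g - f) l_g].  Letting rho tend to 0 in
    the self-prediction property shows that a balanced low-correlation
    self-predicting [g] never disagrees in sign with [l_g], so the second term
    is nonnegative.  If Gap[f] > 0 then Lev(f) = 1, so [l_f] never vanishes and
    has the sign of [f]; hence |l_f| >= Gap[f] everywhere and the first term is
    2 E[|l_f|; f <> g] >= 2 Gap[f] Pr(f <> g). *)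

Section Chow.
Variables (R : realType) (n : nat).
Implicit Types (f g h : boolfun n) (x y : cube n).

Lemma pmvalP f x : pmval R f x = 1 \/ pmval R f x = -1.
Proof. by rewrite /pmval /pm1; case: (f x); [right|left]; rewrite ?expr0 ?expr1. Qed.

Lemma chi_set0 x : chi R set0 x = 1.
Proof. by rewrite /chi big_set0. Qed.

Lemma chi_set1 i x : chi R [set i] x = pm1 R (x i).
Proof. by rewrite /chi big_set1. Qed.

Lemma sum_card1 (F : {set 'I_n} -> R) :
  \sum_(S : {set 'I_n} | #|S| == 1%N) F S = \sum_(i < n) F [set i].
Proof.
have inj : {in predT &, injective (fun i : 'I_n => [set i])}.
  by move=> i j _ _; apply: set1_inj.
rewrite -(big_imset F inj); apply: eq_bigl => S.
apply/cards1P/imsetP => [[i ->]|[i _ ->]]; first by exists i.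
by exists i.
Qed.

Lemma sum_card0 (F : {set 'I_n} -> R) :
  \sum_(S : {set 'I_n} | #|S| == 0%N) F S = F set0.
Proof. by under eq_bigl => S do rewrite cards_eq0; rewrite big_pred1_eq. Qed.

Lemma balanced_fourier0 f : balanced R f -> fourier R f set0 = 0.
Proof.
have two_neq0 : (2 ^ n)%:R != 0 :> R by rewrite pnatr_eq0 expn_eq0.
rewrite /balanced /Pr => bal.
have cardE : #|[pred x | pmval R f x == 1]|%:R = (2 ^ n)%:R / 2 :> R.
  by rewrite -[LHS](divfK two_neq0) bal; ring.
rewrite /fourier /Ex.
under eq_bigr => x _ do rewrite chi_set0 mulr1.
(* Pointwise, a sign is twice the indicator of being 1, minus 1; balancedness makes the two terms
   cancel. *)
suff -> : \sum_x pmval R f x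
        = 2 * #|[pred x | pmval R f x == 1]|%:R - (2 ^ n)%:R.
  by rewrite cardE mulrCA divff ?pnatr_eq0// mulr1 subrr mul0r.
have -> : (2 ^ n)%:R = \sum_(x : cube n) 1 :> R.
  by rewrite sumr_const card_ffun card_bool card_ord.
rewrite -sum1_card natr_sum mulr_sumr [X in X - _]big_mkcond -sumrB.
apply: eq_bigr => x _ /=; rewrite inE.
by have [->|->] := pmvalP f x; [rewrite eqxx|case: eqP]; lra.
Qed.

(** Plancherel at level one: expand the linear form and exchange the two sums. *)
Lemma sum_fourier1M h f :
  \sum_(i < n) fourier1 R h i * fourier1 R f i
  = Ex (fun x => pmval R h x * linear_form R f x).
Proof.
rewrite /Ex.
under [X in _ = X / _]eq_bigr => x _ do rewrite /linear_form mulr_sumr.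
rewrite exchange_big mulr_suml; apply: eq_bigr => i _ /=.
rewrite {1}/fourier1 {1}/fourier /Ex mulrAC mulr_suml; congr (_ / _).
by apply: eq_bigr => x _; rewrite chi_set1; ring.
Qed.

Lemma dChow2E f g :
  dChow R f g ^+ 2
  = Ex (fun x => (pmval R f x - pmval R g x) * linear_form R f x
               + (pmval R g x - pmval R f x) * linear_form R g x).
Proof.
rewrite /dChow sqr_sqrtr; last by apply: sumr_ge0 => i _; rewrite sqr_ge0.
(* The cross term is split evenly, so that each linear form ends up paired with a difference of [f]
   and [g]. *)
have -> : \sum_(i < n) (fourier1 R f i - fourier1 R g i) ^+ 2
   = \sum_(i < n) fourier1 R f i * fourier1 R f i
   - \sum_(i < n) fourier1 R g i * fourier1 R f i
   + (\sum_(i < n) fourier1 R g i * fourier1 R g i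
   - \sum_(i < n) fourier1 R f i * fourier1 R g i).
  by rewrite -!sumrB -big_split; apply: eq_bigr => i _ /=; ring.
rewrite !sum_fourier1M /Ex -!mulrBl -mulrDl -!sumrB -big_split.
by congr (_ / _); apply: eq_bigr => x _ /=; ring.
Qed.

(** First-order expansion of the noise operator at 0: level 0 vanishes, level 1 is the linear form,
    and higher levels carry [rho ^+ #|S| <= rho ^+ 2]. Summing over all [S] on the right only adds
    nonnegative terms. *)
Lemma noise_low_degree (rho : R) g y : 0 <= rho <= 1 -> fourier R g set0 = 0 ->
  `|noise rho g y - rho * linear_form R g y|
  <= rho ^+ 2 * \sum_(S : {set 'I_n}) `|fourier R g S * chi R S y|.
Proof.
move=> /andP[rho0 rho1] g0; rewrite /noise.
rewrite (bigID (fun S : {set 'I_n} => #|S| == 0%N)) /= sum_card0 g0.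
rewrite mulr0 mul0r add0r.
rewrite (bigID (fun S : {set 'I_n} => #|S| == 1%N)) /=.
have -> : \sum_(S : {set 'I_n} | (#|S| != 0%N) && (#|S| == 1%N))
    rho ^+ #|S| * fourier R g S * chi R S y = rho * linear_form R g y.
  rewrite (eq_bigl (fun S : {set 'I_n} => #|S| == 1%N)); last first.
    by move=> S; case: #|S| => [|[|]].
  rewrite sum_card1 /linear_form mulr_sumr; apply: eq_bigr => i _.
  by rewrite cards1 chi_set1 expr1 mulrA.
rewrite addrAC subrr add0r; apply: (le_trans (ler_norm_sum _ _ _)).
rewrite mulr_sumr big_mkcond; apply: ler_sum => S _.
case: ifP => [/andP[S0 S1]|_]; last by rewrite mulr_ge0 ?exprn_ge0.
rewrite -mulrA normrM ler_wpM2r// ger0_norm ?exprn_ge0//.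
by apply: ler_wiXn2l => //; move: S0 S1; case: #|S| => [|[|]].
Qed.

(** Otherwise, for small [rho], the first-order term dominates and gives the noise the sign opposite
    to [g]. *)
Lemma lcsp_linear_form_ge0 g y :
  fourier R g set0 = 0 -> low_correlation_self_predicting R g ->
  0 <= pmval R g y * linear_form R g y.
Proof.
move=> g0 [rs [/andP[rs0 rs1] sp]]; rewrite leNgt; apply/negP => lt0.
set l := linear_form R g y in lt0 *; set p := pmval R g y in lt0 *.
set M := \sum_(S : {set 'I_n}) `|fourier R g S * chi R S y|.
have M0 : 0 <= M by apply: sumr_ge0.
have M1 : 0 < 2 * (M + 1) by lra.
(* The first bound keeps [rho] strictly below [rs]; the second forces [rho * M < - (p * l)], with
   [M + 1] avoiding a division by zero. *)
pose rho := Num.min (rs / 2) (- (p * l) / (2 * (M + 1))).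
have rho0 : 0 < rho.
  by rewrite lt_min divr_gt0//= divr_gt0// oppr_gt0.
have rho_rs : rho <= rs / 2 by rewrite ge_min lexx.
have rhoM : rho * (2 * (M + 1)) <= - (p * l).
  by rewrite -ler_pdivlMr// ge_min lexx orbT.
have rho01 : 0 <= rho <= 1 by apply/andP; split; lra.
have := @noise_low_degree rho g y rho01 g0.
rewrite -/l -/M; set N := noise rho g y => bound.
have spN : N <> 0 -> p = Num.sg N by apply: sp; apply/andP; split; lra.
have pN0 : 0 <= p * N.
  have [->|/eqP N0] := eqVneq N 0; first by rewrite mulr0.
  by rewrite (spN N0) -normrEsg.
have pb : p * (N - rho * l) <= rho ^+ 2 * M.
  apply: le_trans bound; apply: le_trans (ler_norm _) _.
  rewrite normrM /p; have [->|->] := pmvalP g y;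
  by rewrite ?normrN1 ?normr1 mul1r.
(* This quantity bounds [p * N] from above, contradicting [pN0]. *)
have : rho * (rho * M + p * l) < 0 by rewrite pmulr_rlt0//; nra.
by move: pb pN0; rewrite expr2; lra.
Qed.

Lemma linear_form_neg f x :
  linear_form R f [ffun i => ~~ x i] = - linear_form R f x.
Proof.
rewrite /linear_form -sumrN; apply: eq_bigr => i _.
by rewrite ffunE /pm1; case: (x i); rewrite /= ?expr0 ?expr1; ring.
Qed.

(** The antipodal map negates the linear form, so minimality among positive values also controls the
    negative ones. *)
Lemma GapP f : Gap R f != 0 ->
  0 < Gap R f /\ forall x, linear_form R f x != 0 -> Gap R f <= `|linear_form R f x|.
Proof.
rewrite /Gap; case: pickP => [x0 /andP[x0_gt0 /forallP x0_min] _|_];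
  last by rewrite eqxx.
split=> // x; case: (ltgtP (linear_form R f x) 0) => // [lt0|gt0] _.
  rewrite ltr0_norm// -linear_form_neg; apply: (implyP (x0_min _)).
  by rewrite linear_form_neg oppr_gt0.
by rewrite gtr0_norm//; apply: (implyP (x0_min _)).
Qed.

(** A nonzero gap requires a nonzero degree-1 coefficient, hence positive weight at level 1. *)
Lemma Gap_neq0_Lev f : fourier R f set0 = 0 -> Gap R f != 0 -> Lev R f = 1%N.
Proof.
move=> f0 /eqP gap.
have [i fi] : exists i, fourier1 R f i != 0.
  apply/existsP; apply: contra_notT gap => /existsPn fi0.
  rewrite /Gap; case: pickP => // x /andP[+ _].
  rewrite /linear_form big1 ?ltxx// => i _.
  by have /negPn/eqP -> := fi0 i; rewrite mul0r.
have w0 : (0 < weight R f 0) = false by rewrite /weight sum_card0 f0 expr2 mul0r ltxx.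
have w1 : 0 < weight R f 1.
  rewrite /weight sum_card1 (bigD1 i)//= ltr_pwDl//.
    by rewrite exprn_even_gt0.
  by apply: sumr_ge0 => j _; rewrite sqr_ge0.
(* The index [i] shows [0 < n], so the searched list does contain level 1. *)
rewrite /Lev; have -> : iota 0 n.+1 = iota 0 n.-1.+2 by rewrite prednK// (leq_ltn_trans _ (ltn_ord i)).
by rewrite /= w0 w1.
Qed.

Lemma Lev1_fLev f x : Lev R f = 1%N -> fLev R f x = linear_form R f x.
Proof.
move=> L; rewrite /fLev L sum_card1 /linear_form.
by apply: eq_bigr => i _; rewrite chi_set1.
Qed.

End Chow.

Theorem theorem5p13 (R : realType) (n : nat) (f g : boolfun n)
  (f_balanced : balanced R f) (g_balanced : balanced R g)
  (f_lcsp : low_correlation_self_predicting R f)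
  (g_lcsp : low_correlation_self_predicting R g)
  (f_dep : depends_on_all R f) (g_dep : depends_on_all R g)
  (f_sst : strongly_spectral_threshold R f) :
  ((Pr R [pred x | pmval R f x != pmval R g x])%:E <=
     if Gap R f == 0%R then +oo
     else (dChow R f g ^+ 2 / (2 * Gap R f))%R%:E)%E.
Proof.
case: ifPn => [_|gap]; first by rewrite leey.
have [gap0 gap_le] := GapP _ _ _ gap.
have f0 := balanced_fourier0 _ _ _ f_balanced.
have g0 := balanced_fourier0 _ _ _ g_balanced.
have L := Gap_neq0_Lev _ _ _ f0 gap.
rewrite lee_fin ler_pdivlMr ?mulr_gt0// dChow2E /Pr /Ex mulrAC.
rewrite ler_wpM2r ?invr_ge0 ?ler0n//.
(* The inequality already holds pointwise, with the indicator of disagreement times [2 * Gap R f] on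
   the left. *)
rewrite -sum1_card natr_sum mulr_suml big_mkcond; apply: ler_sum => x _ /=.
have [/eqP lf0] := f_sst x.
rewrite (Lev1_fLev _ _ _ _ L) in lf0 * => lfp.
have lgp := @lcsp_linear_form_ge0 R n g x g0 g_lcsp.
have lf_ge := gap_le x lf0.
rewrite inE; case: eqP => [->|] /=; first by rewrite !subrr !mul0r addr0.
(* At a disagreement the integrand is twice [pmval R f x * linear_form R f x], which is the absolute
   value of the form, plus twice the nonnegative quantity in [lgp]. *)
move: lf_ge lfp lgp.
have [->|->] := pmvalP R n f x; have [->|->] := pmvalP R n g x => //.
- by move=> + lf_gt0; rewrite gtr0_norm; lra.
- by move=> + lf_lt0; rewrite ltr0_norm; lra.
Qed.
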